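(* For each $\gamma\in[0,1]$, the set $L^\gamma=\{A\in\Pi(\mathbb{R}):\dim_L(A)=\gamma\}$ is dense in $\Pi(\mathbb{R})$ with respect to the Hausdorff distance.
   Context: $\Pi(\mathbb{R})$ is the collection of all nonempty compact subsets of $\mathbb{R}$ with the Hausdorff distance $\mathfrak{H}(E,F)=\inf\{\epsilon>0: E\subset F_\epsilon \text{ and } F\subset E_\epsilon\}$, where $E_\epsilon$ is the $\epsilon$-neighbourhood of $E$. For a nonempty set $E$, $|E|$ denotes its diameter. The lower (Assouad) dimension of $E\subseteq\mathbb{R}$ is $$\dim_L(E)=\sup\Big\{\beta:\exists M>0 \text{ such that } \forall\, 0<r<R\le|E| \text{ and } x\in E,\ N_r(\mathcal{B}_R(x)\cap E)\ge M\Big(\frac{R}{r}\Big)^\beta\Big\},$$ where $\mathcal{B}_R(x)=\{y:|y-x|\le R\}$ and $N_r(F)$ is the smallest number of open sets required for an $r$-cover of $F$ (a cover by sets of diameter at most $r$). A singleton has lower dimension $0$. *)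

(* Defs.v *)
From HB Require Import structures.
From mathcomp Require Import all_boot all_order all_algebra.
From mathcomp Require Import all_classical all_reals all_analysis.

Set Implicit Arguments.
Unset Strict Implicit.
Unset Printing Implicit Defensive.

Import Order.TTheory GRing.Theory Num.Theory.
Import numFieldNormedType.Exports.

Local Open Scope classical_set_scope.
Local Open Scope ring_scope.

Definition nbhd_set (R : realType) (E : set R) (e : R) : set R :=
  \bigcup_(x in E) ball x e.

(* [inf] is real-valued, with [inf set0 = 0]; for nonempty compact sets the set
   of admissible [e] is nonempty, see [hausdorff_admissible_neq0]. *)
Definition hausdorff_admissible (R : realType) (E F : set R) : set R :=
  [set e | [/\ 0 < e, E `<=` nbhd_set F e & F `<=` nbhd_set E e]].

Definition hausdorff_dist (R : realType) (E F : set R) : R :=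
  inf (hausdorff_admissible E F).

Record compacts (R : realType) := Compacts {
  compacts_set :> set R;
  compacts_compact : compact compacts_set;
  compacts_neq0 : compacts_set !=set0 }.

Arguments compacts_compact {R} c.
Arguments compacts_neq0 {R} c.

HB.instance Definition _ (R : realType) := gen_eqMixin (compacts R).
HB.instance Definition _ (R : realType) := gen_choiceMixin (compacts R).

Section hausdorff_metric.
Context {R : realType}.
Implicit Types (A B C : compacts R) (E F G : set R).

Lemma hausdorff_admissible_neq0 A B : hausdorff_admissible A B !=set0.
Proof.
have bnd C : exists M : R, forall x, (C : set R) x -> `|x| <= M.
  have [M [_ HM]] := compact_bounded (compacts_compact C).
  by exists (M + 1) => x Cx; apply: (HM (M + 1)) => //; rewrite ltrDl.
have [a Aa] := compacts_neq0 A; have [b Bb] := compacts_neq0 B.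
have [M HM] := bnd A; have [N HN] := bnd B.
have MN x y : (A : set R) x -> (B : set R) y -> `|x - y| < M + N + 1.
  move=> /HM xM /HN yN; rewrite (le_lt_trans (ler_normB _ _))//.
  by rewrite (le_lt_trans (lerD xM yN))// ltrDl.
exists (M + N + 1); split.
- exact: le_lt_trans (MN a b Aa Bb).
- by move=> x Ax; exists b => //; rewrite /ball/= distrC; exact: MN.
- by move=> y By; exists a => //; rewrite /ball/=; exact: MN.
Qed.

Lemma hausdorff_dist_ge0 E F : 0 <= hausdorff_dist E F.
Proof.
have [S0|/set0P S0] := eqVneq (hausdorff_admissible E F) set0.
  by rewrite /hausdorff_dist S0 inf0.
by apply: lb_le_inf => // e [/ltW].
Qed.

Lemma hausdorff_dist_lt A B d : hausdorff_dist A B < d ->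
  exists2 e, e < d & hausdorff_admissible A B e.
Proof.
move=> /inf_lt-/(_ (hausdorff_admissible_neq0 A B))[e He ed].
by exists e.
Qed.

Lemma hausdorff_dist_le E F e : hausdorff_admissible E F e ->
  hausdorff_dist E F <= e.
Proof. by move=> He; apply: ge_inf => //; exists 0 => x [/ltW]. Qed.

Lemma hausdorff_distxx A : hausdorff_dist A A = 0.
Proof.
apply/eqP; rewrite eq_le hausdorff_dist_ge0 andbT.
apply/ler_addgt0Pl => e e0; rewrite addr0; apply: hausdorff_dist_le.
by split => // x Ax; exists x => //; exact: ballxx.
Qed.

Lemma hausdorff_distC A B : hausdorff_dist A B = hausdorff_dist B A.
Proof.
by rewrite /hausdorff_dist; congr inf; apply/seteqP; split => e [].
Qed.

Lemma nbhd_setD E F G e1 e2 : E `<=` nbhd_set F e1 -> F `<=` nbhd_set G e2 ->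
  E `<=` nbhd_set G (e2 + e1).
Proof.
move=> EF FG x /EF[y /FG[z Gz zy] yx]; exists z => //.
exact: ball_triangle zy yx.
Qed.

Lemma hausdorff_dist_triangle B A C :
  hausdorff_dist A C <= hausdorff_dist A B + hausdorff_dist B C.
Proof.
apply/ler_addgt0Pl => e e0.
have e20 : 0 < e / 2 by rewrite divr_gt0.
have [|e1 e1d [e1_gt0 AB BA]] := @hausdorff_dist_lt A B (hausdorff_dist A B + e / 2).
  by rewrite ltrDl.
have [|e2 e2d [e2_gt0 BC CB]] := @hausdorff_dist_lt B C (hausdorff_dist B C + e / 2).
  by rewrite ltrDl.
apply: (@le_trans _ _ (e1 + e2)).
  apply: hausdorff_dist_le; split; first exact: addr_gt0.
    by rewrite addrC; exact: nbhd_setD AB BC.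
  exact: nbhd_setD CB BA.
by apply: (le_trans (ltW (ltrD e1d e2d))); rewrite addrACA -splitr addrC.
Qed.

Lemma hausdorff_dist_eq0 A B : hausdorff_dist A B = 0 -> A = B.
Proof.
move=> AB0.
have sub (C D : compacts R) : hausdorff_dist C D = 0 -> (C : set R) `<=` D.
  move=> CD0 x Cx.
  have clD : closed (D : set R).
    exact: (compact_closed (@Rhausdorff R) (compacts_compact D)).
  apply: clD => U /nbhs_ballP[e /= e0 xU].
  have [|d de [_ + _]] := @hausdorff_dist_lt C D e; first by rewrite CD0.
  move=> /(_ x Cx)[y Dy yx]; exists y; split => //; apply: xU.
  by apply: ball_sym; exact: (le_ball (ltW de)) yx.
have eqAB : compacts_set A = compacts_set B.
  by apply/seteqP; split; apply: sub => //; rewrite hausdorff_distC.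
case: A B eqAB {AB0} => [A cA A0] [B cB B0] /= AB.
by move: cA A0; rewrite AB => cA A0; congr Compacts; exact: Prop_irrelevance.
Qed.

End hausdorff_metric.

HB.instance Definition _ (R : realType) :=
  @isMetric.Build R (compacts R) (fun A B => hausdorff_dist A B)
    hausdorff_distxx hausdorff_dist_eq0 hausdorff_distC hausdorff_dist_triangle.

Lemma dense_compactsP (R : realType) (L : set (compacts R)) :
  dense L <-> forall (A : compacts R) (e : R), 0 < e ->
    exists2 B, L B & hausdorff_dist A B < e.
Proof.
split=> [dL A e e0|HL O [A OA] oO].
  have [|B [/interior_subset AB LB]] := dL (ball A e)° _ (open_interior _).
    by exists A; exact: nbhsx_ballx.
  by exists B => //; move: AB; rewrite ballEmdist.
have /nbhs_ballP[e /= e0 AO] := open_nbhs_nbhs (conj oO OA).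
have [B LB AB] := HL A e e0.
by exists B; split => //; apply: AO; rewrite ballEmdist.
Qed.

Local Open Scope ereal_scope.

(* By the convention [ereal_sup set0 = -oo], the empty set has diameter [-oo],
   so it may be used in covers of any mesh. *)
Definition diameter (R : realType) (E : set R) : \bar R :=
  ereal_sup [set `|x - y|%:E | x in E & y in E].

Definition open_cover_of_mesh (R : realType) (r : R) (F : set R) (n : nat)
    (U : 'I_n -> set R) : Prop :=
  [/\ forall i, open (U i), forall i, diameter (U i) <= r%:E &
      F `<=` \bigcup_i U i].

Definition covering_number (R : realType) (r : R) (F : set R) : \bar R :=
  ereal_inf [set n%:R%:E | n in
    [set n | exists U : 'I_n -> set R, open_cover_of_mesh r F U]].

Definition lower_exponent (R : realType) (E : set R) (b : R) : Prop :=
  exists2 M : R, (0 < M)%R & forall r r' : R, (0 < r)%R -> (r < r')%R ->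
    r'%:E <= diameter E -> forall x, E x ->
    (M * (r' / r) `^ b)%:E
      <= covering_number r ([set y | (`|y - x| <= r')%R] `&` E).

(* On a singleton the condition on scales is vacuous and the supremum would be
   [+oo]; the value is 0 by convention. *)
Definition lower_dim (R : realType) (E : set R) : \bar R :=
  if `[< exists x, E = [set x] >] then 0
  else ereal_sup [set b%:E | b in lower_exponent E].

Definition lower_dim_level (R : realType) (g : R) : set (compacts R) :=
  [set A | lower_dim A = g%:E].

(* Main.v *)
(* Let F be a finite net of A contained in A. For 0 < gamma <= 1 take
   l = 2 ^ (- 1 / gamma), so that l <= 1 / 2 and l ^ gamma = 1 / 2, and attach to
   each point of F a copy, scaled by a small d, of the self-similar Cantor set
   generated by x |-> l x and x |-> l x + (1 - l) (the whole interval when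
   l = 1 / 2). The union of the copies is close to A. It is covered by
   |F| 2 ^ n balls of radius of order d l ^ n, so no exponent exceeds gamma.
   Conversely, the 2 ^ k left endpoints of level n + k in a cylinder of level n
   are at mutual distance at least d l ^ (n + k), also when l = 1 / 2, so a cover
   of smaller mesh needs 2 ^ k sets, and gamma is an exponent. For gamma = 0 the
   set F itself works. *)

Require Import Defs.
From mathcomp Require Import all_boot all_order all_algebra.
From mathcomp Require Import all_classical all_reals all_analysis.
From mathcomp Require Import ring lra.
Import Order.TTheory GRing.Theory Num.Theory.
Import numFieldNormedType.Exports.
Local Open Scope classical_set_scope.
Local Open Scope ring_scope.

(** * Points coded by finite words, and geometric scales *)

(** The image of 0 under the maps x |-> l x + b (1 - l) composed along the word, first letter
    outermost: the left endpoint of the cylinder coded by [s]. *)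
Fixpoint cantor_point {R : realType} (l : R) (s : seq bool) : R :=
  if s is b :: s' then b%:R * (1 - l) + l * cantor_point l s' else 0.

Lemma cantor_point_bounds {R : realType} (l : R) (s : seq bool) :
  0 <= l <= 1 -> 0 <= cantor_point l s <= 1 - l ^+ size s.
Proof.
move=> /andP[l0 l1]; elim: s => [|b s /andP[IH0 IH1]] /=.
  by rewrite expr0 subrr lexx.
rewrite exprS; apply/andP; split.
  by rewrite addr_ge0// mulr_ge0// subr_ge0.
have := ler_wpM2l l0 IH1; set c := l ^+ _.
by case: b; rewrite ?mul1r ?mul0r => ?; lra.
Qed.

Lemma cantor_point_cat {R : realType} (l : R) (s t : seq bool) :
  cantor_point l (s ++ t) = cantor_point l s + l ^+ size s * cantor_point l t.
Proof.
elim: s => [|b s IH] /=; first by rewrite expr0 add0r mul1r.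
by rewrite IH exprS; ring.
Qed.

(** Common letters only rescale by [l]. At the first differing letter, with tails of length m, the
    gap is at least (1 - l) - l (1 - l^m), which is at least l^(m + 1) since 2 l <= 1. *)
Lemma cantor_point_sep {R : realType} (l : R) (s t : seq bool) :
  0 <= l <= 2^-1 -> size s = size t -> s != t ->
  l ^+ size s <= `|cantor_point l s - cantor_point l t|.
Proof.
move=> /andP[l0 l2]; have l01 : 0 <= l <= 1 by apply/andP; split => //; lra.
elim: s t => [|b s IH] [|c t]//= [st] bst.
have := cantor_point_bounds _ s l01; have := cantor_point_bounds _ t l01.
rewrite -st => /andP[t0 t1] /andP[s0 s1].
have [bc|bc] := eqVneq b c.
  subst c; rewrite opprD addrACA subrr add0r -mulrBr normrM ger0_norm// exprS.
  by rewrite ler_wpM2l// IH//; apply: contraNneq bst => ->.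
have := ler_wpM2l l0 s1; have := ler_wpM2l l0 t1.
have := mulr_ge0 l0 s0; have := mulr_ge0 l0 t0; rewrite exprS.
set x := l * cantor_point l s; set y := l * cantor_point l t.
set z := l ^+ _ => ? ? ? ?.
rewrite ler_normr; apply/orP.
by case: b c bc {bst} => -[]//= _; rewrite ?mul1r ?mul0r; [left|right]; lra.
Qed.

(** The word [p] is the prefix of [s] of length [n]; both points then lie in one cylinder of length
    l^n. *)
Lemma cantor_point_approx {R : realType} (l : R) (s : seq bool) (n : nat) :
  0 <= l <= 1 -> exists2 p, size p = n &
    forall w, `|cantor_point l s - cantor_point l (p ++ w)| <= l ^+ n.
Proof.
move=> l01; have /andP[l0 l1] := l01; elim: n s => [|n IH] s.
  exists [::] => // w; rewrite expr0 ler_norml /=.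
  have /andP[? ?] := cantor_point_bounds _ s l01.
  have /andP[? ?] := cantor_point_bounds _ w l01.
  have := exprn_ge0 (size s) l0; have := exprn_ge0 (size w) l0.
  move=> ? ?; apply/andP; split; lra.
case: s => [|b s].
  (* A word that is too short is padded with [false], which does not move its point. *)
  have [p sp Hp] := IH [::]; exists (false :: p); rewrite /= ?sp// => w.
  have := Hp w; rewrite /= mul0r !add0r !normrN => Hw.
  by rewrite normrM ger0_norm// exprS ler_wpM2l.
have [p sp Hp] := IH s; exists (b :: p); rewrite /= ?sp// => w.
by rewrite opprD addrACA subrr add0r -mulrBr normrM ger0_norm// exprS ler_wpM2l.
Qed.

(** The least [m] with l^m <= u works: the preceding power exceeds [u], and at m = 0 the hypothesis
    u <= 1 takes over. *)
Lemma geometric_scale {R : realType} (l u : R) :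
  0 < l < 1 -> 0 < u <= 1 -> exists2 m, l ^+ m <= u & l * u < l ^+ m.
Proof.
move=> /andP[l0 l1] /andP[u0 u1].
have ex : exists m, l ^+ m <= u.
  have /cvgrPdist_lt/(_ _ u0)[m _ /(_ m (leqnn m))/=] :
      l ^+ n @[n --> \oo] --> (0 : R).
    by apply: cvg_expr; rewrite ger0_norm// ltW.
  rewrite sub0r normrN => H; exists m.
  by apply: le_trans (ltW H); exact: ler_norm.
exists (ex_minn ex); case: ex_minnP => [m Hm mmin] //.
case: m Hm mmin => [|m] Hm mmin.
  by rewrite expr0 (lt_le_trans _ u1)// gtr_pMl.
rewrite exprS ltr_pM2l// ltNge; apply/negP => /mmin.
by rewrite ltnn.
Qed.

(** * Covering numbers and bounds on exponents *)

(** Pigeonhole: a set of diameter at most [r] contains at most one of the points. *)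
Lemma covering_number_ge {R : realType} (r : R) (S : set R) (T : finType)
    (p : T -> R) :
  (forall i, S (p i)) -> (forall i j, i != j -> r < `|p i - p j|) ->
  (#|T|%:R%:E <= covering_number r S)%E.
Proof.
move=> Sp psep; apply/ereal_infP => _ [n [U [oU dU SU]] <-].
rewrite lee_fin ler_nat.
have /choice[f Hf] : forall t, exists i : 'I_n, U i (p t).
  by move=> t; have [i _ Ui] := SU _ (Sp t); exists i.
rewrite -[n]card_ord; apply: (@leq_card _ _ f) => i j fij.
apply/eqP; apply: contraT => /psep; rewrite ltNge -lee_fin => /negP[].
apply: le_trans (dU (f i)); apply: ereal_sup_ubound.
by exists (p i) => //; exists (p j) => //; rewrite fij.
Qed.

Lemma covering_number_le {R : realType} (r : R) (S : set R) (T : finType)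
    (c : T -> R) :
  (forall x, S x -> exists i, ball (c i) r x) ->
  (covering_number (2 * r) S <= #|T|%:R%:E)%E.
Proof.
move=> Sc; apply: ereal_inf_lbound; exists #|T| => //=.
exists (fun i => ball (c (enum_val i)) r); split => [i|i|x /Sc[i xi]].
- exact: ball_open.
- apply/ereal_supP => _ [x xi [y yi <-]]; rewrite lee_fin.
  move: xi yi; rewrite /ball/= => xi yi.
  rewrite -(subrKA (c (enum_val i))) (le_trans (ler_normD _ _))// mulr_natl mulr2n.
  by rewrite lerD// ?(distrC x) ltW.
- by exists (enum_rank i) => //; rewrite enum_rankK.
Qed.

(** The large scale is frozen at the distance D of two points. An exponent b > g would give M (D /
    r)^b <= C r^(-g) for arbitrarily small [r], hence a bound on r^(-(b - g)). *)
Lemma lower_exponent_le {R : realType} (E : set R) (g C b : R) :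
  0 < C -> (exists x y, [/\ E x, E y & x != y]) ->
  (forall e, 0 < e -> exists2 r, 0 < r < e &
     forall S, S `<=` E -> (covering_number r S <= (C * (r^-1) `^ g)%:E)%E) ->
  lower_exponent E b -> b <= g.
Proof.
move=> C0 [x [y [Ex Ey xy]]] cov [M M0 HM].
rewrite leNgt; apply/negP => gb.
pose D := `|x - y|; have D0 : 0 < D by rewrite normr_gt0 subr_eq0.
have bg0 : 0 < b - g by rewrite subr_gt0.
pose K := C / (M * D `^ b).
have Db0 : 0 < D `^ b by exact: powR_gt0.
have K0 : 0 < K by rewrite divr_gt0// mulr_gt0.
pose e := Num.min D ((K^-1) `^ (b - g)^-1).
have e0 : 0 < e by rewrite lt_min D0 powR_gt0// invr_gt0.
have [r /andP[r0 re] Hr] := cov _ e0.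
have rD : r < D by rewrite (lt_le_trans re)// ge_min lexx.
have DE : (D%:E <= diameter E)%E.
  by apply: ereal_sup_ubound; exists x => //; exists y.
have := le_trans (HM r D r0 rD DE x Ex) (Hr _ (@subIsetr _ _ _)).
rewrite lee_fin leNgt => /negP; apply.
have ri0 : 0 < r^-1 by rewrite invr_gt0.
have -> : (D / r) `^ b = D `^ b * (r^-1 `^ (b - g) * r^-1 `^ g).
  rewrite powRM ?ltW// -powRD ?subrK//.
  by apply/implyP => _; rewrite gt_eqF.
rewrite !mulrA ltr_pM2r ?powR_gt0// mulrC -ltr_pdivrMr ?mulr_gt0// -/K.
have KE : K = (K `^ (b - g)^-1) `^ (b - g).
  by rewrite -powRrM mulVf ?gt_eqF// powRr1// ltW.
rewrite KE; apply: gt0_ltr_powR => //; rewrite ?nnegrE ?powR_ge0 ?(ltW ri0)//.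
have : r < (K^-1) `^ (b - g)^-1 by rewrite (lt_le_trans re)// ge_min lexx orbT.
rewrite -(@ltf_pV2 _ _ r) ?posrE ?powR_gt0 ?invr_gt0//.
by rewrite -[K^-1]powR_inv1 ?ltW// -powRrM mulN1r powRN invrK.
Qed.

Lemma lower_dim_eq {R : realType} (E : set R) (g C : R) :
  0 < C -> (exists x y, [/\ E x, E y & x != y]) ->
  (forall e, 0 < e -> exists2 r, 0 < r < e &
     forall S, S `<=` E -> (covering_number r S <= (C * (r^-1) `^ g)%:E)%E) ->
  lower_exponent E g -> lower_dim E = g%:E.
Proof.
move=> C0 nE cov Eg; rewrite /lower_dim; case: asboolP => [[z Ez]|_].
  by have [x [y [+ + /eqP[]]]] := nE; rewrite Ez => -> ->.
apply/eqP; rewrite eq_le; apply/andP; split; last first.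
  by apply: ereal_sup_ubound; exists g.
apply/ereal_supP => _ [b Eb <-]; rewrite lee_fin.
exact: lower_exponent_le C0 nE cov Eb.
Qed.

(** * Unions of Cantor copies and their dimension *)

(** Only endpoints coded by finite words are taken; the closure supplies the remaining points of the
    copies. *)
Definition cantor_copies {R : realType} (F : seq R) (d l : R) : set R :=
  [set x | exists f s, f \in F /\ x = f + d * cantor_point l s].

Lemma closure_ball {R : realType} {E : set R} {x e : R} :
  closure E x -> 0 < e -> exists2 y, E y & `|y - x| < e.
Proof.
move=> Ex e0; have [y [Ey]] := Ex _ (nbhsx_ballx x e e0).
by rewrite /ball/= distrC; exists y.
Qed.

(** The centres are the endpoints of level [n]. One [rho] pays for the closure and one for the
    cylinder, so radius 2 rho suffices. Keeping [rho] apart from d l^n admits d = 0. *)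
Lemma covering_number_cantor_copies {R : realType} (F : seq R) (d l rho : R)
    (n : nat) (S : set R) :
  0 <= l <= 1 -> 0 <= d -> 0 < rho -> d * l ^+ n <= rho ->
  S `<=` closure (cantor_copies F d l) ->
  (covering_number (4 * rho) S <= ((size F)%:R * 2 ^+ n)%:E)%E.
Proof.
move=> l01 d0 rho0 dln SE.
have -> : 4 * rho = 2 * (2 * rho) by ring.
have := @covering_number_le R (2 * rho) S ('I_(size F) * n.-tuple bool)%type
  (fun ip => F`_(ip.1) + d * cantor_point l ip.2).
rewrite card_prod card_ord card_tuple card_bool natrM natrX; apply.
move=> x /SE Ex.
have [_ [f [s [fF ->]]] yx] := closure_ball Ex rho0.
have [p sp Hp] := cantor_point_approx l s n l01.
move: fF; rewrite -index_mem => fF.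
have spn : size p == n by rewrite sp.
exists (Ordinal fF, Tuple spn) => /=.
rewrite /ball/= nth_index -?index_mem//.
have := Hp [::]; rewrite cats0 => /(ler_wpM2l d0).
rewrite -[X in X * `|_|](ger0_norm d0) -normrM => Hd.
have {}Hd := le_trans Hd dln.
rewrite -(subrKA (f + d * cantor_point l s)) (le_lt_trans (ler_normD _ _))//.
rewrite mulr_natl mulr2n ler_ltD// (le_trans _ Hd)// distrC.
by rewrite le_eqVlt; apply/orP; left; apply/eqP; congr `|_|; ring.
Qed.

Lemma ratio_powR {R : realType} (l g : R) (n : nat) :
  0 < l -> l `^ g = 2^-1 -> ((l ^+ n)^-1) `^ g = 2 ^+ n.
Proof.
move=> l0 lg; rewrite -[_^-1]powR_inv1 ?exprn_ge0 ?(ltW l0)//.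
rewrite -powRrM mulN1r powRN -powR_mulrn ?(ltW l0)//.
by rewrite -powRrM mulrC powRrM lg powR_mulrn// exprVn invrK.
Qed.

Lemma lower_exponent_cantor_copies {R : realType} (F : seq R) (d l g D : R) :
  0 < l <= 2^-1 -> l `^ g = 2^-1 -> 0 < d -> 0 < D -> 0 <= g ->
  (diameter (closure (cantor_copies F d l)) <= D%:E)%E ->
  lower_exponent (closure (cantor_copies F d l)) g.
Proof.
move=> /andP[l0 l2] lg d0 D0 g0 diamE.
have l01 : 0 <= l <= 1 by apply/andP; split; lra.
have l01' : 0 < l < 1 by apply/andP; split; lra.
(* The level [n] chosen below has d l^n > l min(d, r' / 2), and r' <= D turns this into c r' <= d
   l^n. *)
pose c := l * Num.min (d / D) 2^-1.
have c0 : 0 < c by rewrite mulr_gt0// lt_min divr_gt0//= invr_gt0.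
exists (c `^ g / 2); first by rewrite divr_gt0// powR_gt0.
move=> r r' r0 rr' r'E x Ex.
have r'0 : 0 < r' by exact: lt_trans rr'.
have r'D : r' <= D by rewrite -lee_fin (le_trans r'E).
have r'20 : 0 < r' / 2 by rewrite divr_gt0.
have [_ [f [s [fF ->]]] yx] := closure_ball Ex r'20.
(* The size r' / 2 relative to a copy, capped at 1 for radii larger than the copy. *)
pose u := Num.min 1 (r' / 2 / d).
have u0 : 0 < u by rewrite lt_min ltr01/= !divr_gt0.
have u1 : 0 < u <= 1 by rewrite u0 ge_min lexx.
have [n lnu uln] := geometric_scale _ _ l01' u1.
have dlr' : d * l ^+ n <= r' / 2.
  by rewrite mulrC -ler_pdivlMr// (le_trans lnu)// ge_min lexx orbT.
have cr' : c * r' <= d * l ^+ n.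
  apply: le_trans (ler_wpM2l (ltW d0) (ltW uln)).
  rewrite /c -mulrA [leRHS]mulrCA ler_wpM2l ?(ltW l0)//.
  rewrite /u mulrC; have [_|_] := leP 1 (r' / 2 / d).
    rewrite mulr1 (@le_trans _ _ (r' * (d / D)))//.
      by rewrite ler_wpM2l ?(ltW r'0)// ge_min lexx.
    by rewrite mulrCA ler_piMr ?(ltW d0)// ler_pdivrMr// mul1r.
  rewrite [leRHS]mulrC divfK ?gt_eqF// ler_wpM2l ?(ltW r'0)//.
  by rewrite ge_min lexx orbT.
have [p sp Hp] := cantor_point_approx l s n l01.
pose q w := f + d * cantor_point l (p ++ w).
set S := _ `&` _.
(* The whole cylinder of [p] stays in the ball: r' / 2 for the approximation of [x], and d l^n <= r'
   / 2 for the cylinder. *)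
have Sq w : S (q w).
  split; last by apply: subset_closure; exists f, (p ++ w).
  rewrite /= -(subrKA (f + d * cantor_point l s)) (le_trans (ler_normD _ _))//.
  rewrite [leRHS]splitr lerD ?(ltW yx)// (le_trans _ dlr')//.
  rewrite distrC /q opprD addrACA subrr add0r -mulrBr normrM gtr0_norm//.
  by rewrite ler_wpM2l// ltW.
have bound (k : nat) (v : R) : v <= 2 ^+ k -> r < d * l ^+ (n + k) ->
  (v%:E <= covering_number r S)%E.
  move=> vk rk.
  have := @covering_number_ge R r _ (k.-tuple bool) (fun w => q w) (fun w => Sq w).
  rewrite card_tuple card_bool natrX => H.
  apply: le_trans (H _); first by rewrite lee_fin.
  move=> w w' ww'; apply: (lt_le_trans rk).
  rewrite /q opprD addrACA subrr add0r -mulrBr normrM gtr0_norm// ler_pM2l//.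
  rewrite !cantor_point_cat opprD addrACA subrr add0r -mulrBr normrM.
  rewrite sp ger0_norm ?exprn_ge0 ?(ltW l0)// exprD.
  rewrite ler_wpM2l ?exprn_ge0 ?(ltW l0)//.
  rewrite -{1}(size_tuple w) cantor_point_sep ?size_tuple//.
  by rewrite (ltW l0).
have crr : c `^ g / 2 * (r' / r) `^ g <= (d * l ^+ n / r) `^ g / 2.
  rewrite mulrAC ler_pM2r ?invr_gt0//.
  rewrite -powRM ?(ltW c0) ?divr_ge0 ?(ltW r0) ?(ltW r'0)//.
  apply: ge0_ler_powR; rewrite ?nnegrE//.
  - by rewrite mulr_ge0 ?divr_ge0// ltW.
  - by rewrite divr_ge0 ?mulr_ge0 ?exprn_ge0// ltW.
  - by rewrite mulrA ler_pM2r ?invr_gt0.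
apply: (@le_trans _ _ ((d * l ^+ n / r) `^ g / 2)%:E); first by rewrite lee_fin.
have dln0 : 0 < d * l ^+ n by rewrite mulr_gt0// exprn_gt0.
pose v := r / (d * l ^+ n).
have v0 : 0 < v by rewrite divr_gt0.
have vE : d * l ^+ n / r = v^-1 by rewrite /v invf_div.
rewrite vE.
(* If [r] is at least the cylinder size, the required bound is at most 1 and one point is enough. *)
have [v1|v1] := leP 1 v.
  have := @covering_number_ge R r _ unit (fun=> q [::]) (fun=> Sq [::]).
  rewrite card_unit => H; apply: le_trans (H _); last by case; case.
  rewrite lee_fin ler_pdivrMr// mul1r (@le_trans _ _ 1)// ?ler1n//.
  have g1 : 1 `^ g = 1 :> R by rewrite powR1.
  rewrite -[leRHS]g1 ge0_ler_powR ?nnegrE ?invr_ge0 ?(ltW v0)//.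
  by rewrite invf_le1.
(* Here l^(k + 1) <= v < l^k: the right inequality separates the endpoints [k] levels down, the left
   gives v^(-g) <= 2^(k + 1). The lost level is the factor 1/2 in the constant. *)
have [|[|k] lkv vlk] := geometric_scale l v l01'; first by rewrite v0 ltW.
  by move: lkv; rewrite expr0 leNgt v1.
apply: (bound k).
  rewrite ler_pdivrMr// -exprSr.
  rewrite -(ratio_powR _ _ k.+1 l0 lg).
  have lk0 := exprn_gt0 k.+1 l0.
  rewrite ge0_ler_powR ?nnegrE ?invr_ge0 ?(ltW v0) ?(ltW lk0)//.
  by rewrite lef_pV2.
move: vlk; rewrite exprS ltr_pM2l// /v ltr_pdivrMr// exprD => /lt_le_trans; apply.
by rewrite mulrC -mulrA.
Qed.

Lemma diameter_le {R : realType} (E : set R) (K : R) :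
  (forall x, E x -> `|x| <= K) -> (diameter E <= (2 * K)%:E)%E.
Proof.
move=> EK; apply/ereal_supP => _ [x Ex [y Ey <-]]; rewrite lee_fin.
by rewrite (le_trans (ler_normB _ _))// mulr_natl mulr2n lerD// EK.
Qed.

Lemma lower_dim_cantor_copies {R : realType} (F : seq R) (d l g K : R) :
  0 < l <= 2^-1 -> l `^ g = 2^-1 -> 0 < d -> 0 <= g -> F != [::] ->
  (forall x, closure (cantor_copies F d l) x -> `|x| <= K) ->
  lower_dim (closure (cantor_copies F d l)) = g%:E.
Proof.
move=> l02 lg d0 g0 F0 EK; have /andP[l0 l2] := l02.
have l01 : 0 <= l <= 1 by apply/andP; split; lra.
have l01' : 0 < l < 1 by apply/andP; split; lra.
have copy f s : f \in F ->
    closure (cantor_copies F d l) (f + d * cantor_point l s).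
  by move=> fF; apply: subset_closure; exists f, s.
have [f fF] : exists f, f \in F.
  by case: (F) F0 => // f F' _; exists f; rewrite mem_head.
have K0 : 0 <= K by rewrite (le_trans _ (EK _ (copy f [::] fF))).
have diamE : (diameter (closure (cantor_copies F d l)) <= (2 * K + 1)%:E)%E.
  by rewrite (le_trans (diameter_le _ _ EK))// lee_fin lerDl.
(* At mesh r = 4 d l^n, the factor (4 d)^g r^(-g) equals 2^n. *)
apply: (@lower_dim_eq _ _ _ ((size F)%:R * (4 * d) `^ g)).
- by rewrite mulr_gt0 ?powR_gt0 ?mulr_gt0// ltr0n lt0n size_eq0.
- exists (f + d * cantor_point l [::]), (f + d * cantor_point l [:: true]).
  split; [exact: copy|exact: copy|].
  by rewrite -subr_eq0 /= !mulr0 addr0 mul1r addr0 opprD addrA subrr add0r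
    oppr_eq0 mulf_neq0 ?gt_eqF// subr_gt0; have /andP[] := l01'.
- move=> e e0; have e4 : 0 < e / (4 * d) by rewrite divr_gt0// mulr_gt0.
  have /cvgrPdist_lt/(_ _ e4)[n _ /(_ n (leqnn n))/=] :
      l ^+ n @[n --> \oo] --> (0 : R).
    by apply: cvg_expr; rewrite ger0_norm ?(ltW l0)//; have /andP[] := l01'.
  have ln0 := exprn_gt0 n l0.
  rewrite sub0r normrN gtr0_norm// ltr_pdivlMr ?mulr_gt0// => lne.
  have r0 : 0 < 4 * (d * l ^+ n) by rewrite !mulr_gt0.
  exists (4 * (d * l ^+ n)); first by rewrite r0 mulrA mulrC.
  move=> S SE.
  have dln0 : 0 < d * l ^+ n by rewrite mulr_gt0.
  apply: le_trans
    (covering_number_cantor_copies F d l _ n S l01 (ltW d0) dln0 (lexx _) SE) _.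
  rewrite lee_fin -mulrA ler_wpM2l// mulrA.
  rewrite -powRM ?invr_ge0 ?mulr_ge0 ?(ltW d0) ?(ltW ln0)//.
  rewrite invfM mulrA mulfV ?mul1r ?gt_eqF ?mulr_gt0//.
  by rewrite (ratio_powR _ _ n l0 lg).
- by apply: lower_exponent_cantor_copies l02 lg d0 _ g0 diamE;
    rewrite ltr_wpDl// mulr_ge0.
Qed.

(* With [d = 0] the closure is the finite set [F] itself. *)
Lemma lower_dim_finite {R : realType} (F : seq R) :
  F != [::] -> lower_dim (closure (cantor_copies F 0 0)) = 0%:E.
Proof.
move=> F0; set E := closure _.
have [single|nsingle] := pselect (exists x, E = [set x]).
  by rewrite /lower_dim; case: asboolP.
have [f fF] : exists f, f \in F.
  by case: (F) F0 => // f F' _; exists f; rewrite mem_head.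
have Ef : E f by apply: subset_closure; exists f, [::]; rewrite mul0r addr0.
apply: (@lower_dim_eq _ _ _ (size F)%:R).
- by rewrite ltr0n lt0n size_eq0.
- apply: contrapT => H; apply: nsingle; exists f.
  apply/seteqP; split => [y Ey|_ ->//].
  by apply: contrapT => /eqP yf; apply: H; exists y, f.
(* With d = 0, level 0 suffices at every scale; the mesh is e / 2. *)
- move=> e e0; exists (4 * (e / 8)); first by apply/andP; split; lra.
  move=> S SE; have e8 : 0 < e / 8 by lra.
  rewrite powRr0; apply: (covering_number_cantor_copies F 0 0 _ 0 S _ _ e8 _ SE) => //.
    by rewrite lexx ler01.
  by rewrite mul0r ltW.
- exists 1 => // r r' r0 rr' _ x Ex; rewrite powRr0 mulr1.
  have := @covering_number_ge R r ([set y | `|y - x| <= r'] `&` E) unit (fun=> x).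
  rewrite card_unit; apply; last by case; case.
  by move=> _; split => //=; rewrite subrr normr0 ltW// (lt_trans r0).
Qed.

(** * Choice of parameters and density *)

Lemma exists_ratio {R : realType} (g : R) : 0 < g <= 1 ->
  exists2 l, 0 < l <= 2^-1 & l `^ g = 2^-1.
Proof.
move=> /andP[g0 g1]; have h0 : 0 < 2^-1 :> R by rewrite invr_gt0.
exists (2^-1 `^ g^-1); last by rewrite -powRrM mulVf ?gt_eqF// powRr1// ltW.
rewrite powR_gt0//= ge1r_powR ?h0 ?invf_le1 ?ler1n//.
by rewrite invf_ge1.
Qed.

Lemma compact_net {R : realType} (A : set R) (e : R) :
  compact A -> 0 < e -> exists2 F : seq R, {in F, forall f, A f} &
    forall x, A x -> exists2 f, f \in F & ball f e x.
Proof.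
rewrite compact_cover => cA e0.
have [|x Ax|F FA AF] := cA R A (fun x => ball x e).
- by move=> x _; exact: ball_open.
- by exists x => //; exact: ballxx.
- exists (finmap.enum_fset F) => [f /FA|x /AF[f fF fx]]; first by rewrite inE.
  by exists f.
Qed.

Theorem theorem3p1 (R : realType) (gamma : R) (hgamma : 0 <= gamma <= 1) :
  dense (lower_dim_level gamma).
Proof.
apply/dense_compactsP => A e e0.
have e4 : 0 < e / 4 by rewrite divr_gt0.
have [F FA AF] := compact_net _ _ (compacts_compact A) e4.
have [a Aa] := compacts_neq0 A.
have F0 : F != [::] by have [f + _] := AF a Aa; case: (F).
have [M HM] : exists M : R, forall x, (A : set R) x -> `|x| <= M.
  have [M [_ HM]] := compact_bounded (compacts_compact A).
  by exists (M + 1) => x Ax; apply: (HM (M + 1)) => //; rewrite ltrDl.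
(* Closeness to [A] holds for all these [d] and [l]. The dimension is asked for under a bound [K],
   which closeness to [A] then provides. *)
suff [d [l [d0 l01 dimE]]] : exists d l : R, [/\ 0 <= d <= e / 4, 0 <= l <= 1 &
    (forall K : R, (forall x, closure (cantor_copies F d l) x -> `|x| <= K) ->
      lower_dim (closure (cantor_copies F d l)) = gamma%:E)].
  set E := closure _ in dimE.
  have EA x : E x -> exists2 f, (A : set R) f & `|f - x| < 2 * (e / 4).
    move=> Ex; have [_ [f [s [fF ->]]] yx] := closure_ball Ex e4.
    exists f; first exact: FA.
    have /andP[p0 p1] := cantor_point_bounds l s l01.
    have /andP[d0' de] := d0; have /andP[l0 _] := l01.
    have := ler_pM d0' p0 de (le_trans p1 _ : _ <= 1).
    rewrite gerBl exprn_ge0// => /(_ isT); rewrite mulr1 => dp.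
    rewrite -(subrKA (f + d * cantor_point l s)) (le_lt_trans (ler_normD _ _))//.
    rewrite mulr_natl mulr2n ler_ltD// opprD addrA subrr add0r normrN.
    by rewrite ger0_norm// mulr_ge0.
  have EK x : E x -> `|x| <= M + 2 * (e / 4).
    move=> /EA[f /HM fM fx]; rewrite -[x](subKr f).
    by rewrite (le_trans (ler_normB _ _))// lerD// ltW.
  have cE : compact E.
    pose K := M + 2 * (e / 4).
    apply: (subclosed_compact _ (@segment_compact _ (- K) K)).
      exact: closed_closure.
    by move=> x /EK; rewrite ler_norml /= in_itv.
  have AE x : (A : set R) x -> exists2 y, E y & `|y - x| < e / 4.
    move=> /AF[f fF fx]; exists f => //; apply: subset_closure.
    by exists f, [::]; rewrite mulr0 addr0.
  have nE : E !=set0 by have [y Ey _] := AE a Aa; exists y.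
  exists (@Compacts R E cE nE); first exact: dimE EK.
  apply: (@le_lt_trans _ _ (2 * (e / 4))); last by lra.
  apply: hausdorff_dist_le; split => [|x /AE[y Ey yx]|x /EA[y Ay yx]].
  - by rewrite mulr_gt0.
  - by exists y => //; rewrite /ball/= (lt_trans yx)// ltr_pMl// ltr1n.
  - by exists y.
have /andP[g0 g1] := hgamma.
(* No ratio satisfies l^0 = 1/2, so gamma = 0 uses the finite net. *)
have [->|gn0] := eqVneq gamma 0.
  exists 0, 0; split; rewrite ?lexx ?ler01 ?(ltW e4)// => _ _.
  exact: lower_dim_finite.
have [|l l02 lg] := exists_ratio gamma; first by rewrite lt_def gn0 g0.
exists (e / 4), l; split; first by rewrite lexx ltW.
  by have /andP[? ?] := l02; apply/andP; split; lra.
by move=> K; exact: lower_dim_cantor_copies.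
Qed.
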